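(* Let $n\ge 1$. The restriction of $\rho\colon \Gamma_n\to \mathbf{O}(n)$ to the pinor group $\mathbf{Pin}(n)$ is a surjective homomorphism $\rho\colon \mathbf{Pin}(n)\to \mathbf{O}(n)$ whose kernel is $\{-1,1\}$, and the restriction of $\rho$ to the spinor group $\mathbf{Spin}(n)$ is a surjective homomorphism $\rho\colon \mathbf{Spin}(n)\to \mathbf{SO}(n)$ whose kernel is $\{-1,1\}$.
   Context: Let $\Phi(x_1,\dots,x_n)=-(x_1^2+\cdots+x_n^2)$ on $\mathbb{R}^n$. The Clifford algebra $\mathrm{Cl}_n$ is the real unital associative algebra $T(\mathbb{R}^n)/\mathfrak{A}$, where $T(\mathbb{R}^n)$ is the tensor algebra and $\mathfrak{A}$ is the two-sided ideal generated by all $v\otimes v-\Phi(v)\cdot 1$, $v\in\mathbb{R}^n$ (so $v^2=\Phi(v)\cdot 1$). The canonical map $\mathbb{R}^n\to\mathrm{Cl}_n$ is injective and $\mathbb{R}^n$ is identified with its image. $t$ is the unique anti-automorphism of $\mathrm{Cl}_n$ that is the identity on $\mathbb{R}^n$; $\alpha$ is the unique algebra automorphism of $\mathrm{Cl}_n$ with $\alpha(v)=-v$ for $v\in\mathbb{R}^n$; $\overline{x}=t(\alpha(x))$; $N(x)=x\overline{x}$. $\mathrm{Cl}_n^0=\{x\in\mathrm{Cl}_n\mid \alpha(x)=x\}$. The Clifford group is $\Gamma_n=\{x\in\mathrm{Cl}_n^*\mid \alpha(x)vx^{-1}\in\mathbb{R}^n \text{ for all } v\in\mathbb{R}^n\}$,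 where $\mathrm{Cl}_n^*$ is the group of units, and $\Gamma_n^+=\Gamma_n\cap\mathrm{Cl}_n^0$. For $x\in\Gamma_n$, $\rho(x)$ is the linear map $v\mapsto\alpha(x)vx^{-1}$ of $\mathbb{R}^n$; it lies in the orthogonal group $\mathbf{O}(n)$. The norm $N$ restricts to a homomorphism $N\colon\Gamma_n\to\mathbb{R}^*\cdot 1$ (with $\mathbb{R}^*=\mathbb{R}-\{0\}$), $\mathbf{Pin}(n)=\{x\in\Gamma_n\mid N(x)=1\}$ is its kernel, and $\mathbf{Spin}(n)=\mathbf{Pin}(n)\cap\Gamma_n^+$. *)

(* Defs.v *)
From HB Require Import structures.
From mathcomp Require Import all_boot all_order all_algebra.
From mathcomp Require Import finmap.
From mathcomp Require Import boolp classical_sets reals.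
From mathcomp Require Import monalg.

Set Implicit Arguments.
Unset Strict Implicit.
Unset Printing Implicit Defensive.

Import Order.TTheory GRing.Theory Num.Theory.

Local Open Scope classical_set_scope.
Local Open Scope ring_scope.

Lemma malg_scaleU (K : choiceType) (R : nzRingType) (a b : R) (k : K) :
  << a * b *g k >> = a *: << b *g k >> :> {malg R[K]}.
Proof. by apply/malgP => k'; rewrite mcoeffZ !mcoeffU mulrnAr. Qed.

Lemma malg_scaleAr (K : monomType) (R : comNzRingType) (a : R)
  (x y : {malg R[K]}) : a *: (x * y) = x * (a *: y).
Proof.
apply/malgP => k; rewrite mcoeffZ.
rewrite (mcoeffMlw k (fsubset_refl _) (fsubset_refl _)).
rewrite (mcoeffMlw k (fsubset_refl _) (msuppZ_le a y)).
rewrite mulr_sumr; apply: eq_bigr => k1 _.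
rewrite mulr_sumr; apply: eq_bigr => k2 _.
by rewrite mcoeffZ mulrnAr mulrCA.
Qed.

(* In the standard basis, T(R^n) is the algebra of the free monoid on n
   letters: the word i1 ... ik stands for e_i1 (x) ... (x) e_ik.  That this is
   the tensor algebra is tensor_liftE together with tensor_hom_ext,
   the existence and uniqueness halves of its universal property. *)
Definition tensor (R : realType) (n : nat) := {malg R[{fmonom 'I_n}]}.

HB.instance Definition _ (R : realType) n := GRing.Lalgebra.on (tensor R n).

HB.instance Definition _ (R : realType) n :=
  GRing.Lalgebra_isAlgebra.Build R (tensor R n) (@malg_scaleAr _ R).

Section TensorAlgebra.
Variables (R : realType) (n : nat).

Definition tensor_vec (v : 'cV[R]_n) : tensor R n :=
  \sum_i << v i 0 *g fmu i >>.

Lemma tensor_vec_is_linear : linear tensor_vec.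
Proof.
move=> a u v; rewrite /tensor_vec scaler_sumr -big_split /=.
by apply: eq_bigr => i _; rewrite 2!mxE monalgUD malg_scaleU.
Qed.

HB.instance Definition _ :=
  GRing.isLinear.Build R 'cV[R]_n (tensor R n) _ tensor_vec
    tensor_vec_is_linear.

Section Lift.
Variables (A : algType R) (f : 'cV[R]_n -> A).

Definition word_lift (w : {fmonom 'I_n}) : A :=
  \prod_(i <- w) f (delta_mx i 0).

Lemma word_lift_mmorphism : mmorphism word_lift.
Proof.
split=> [x y|]; rewrite /word_lift; first by rewrite fmM big_cat.
by rewrite fm1 big_nil.
Qed.

HB.instance Definition _ :=
  monalg.isMultiplicative.Build {fmonom 'I_n} A word_lift word_lift_mmorphism.

Definition tensor_lift (x : tensor R n) : A := mmap (in_alg A) word_lift x.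

Lemma tensor_lift_is_monoid_morphism : monoid_morphism tensor_lift.
Proof.
have [|M one] :=
  @commr_mmap_is_multiplicative {fmonom 'I_n} R A (in_alg A) word_lift.
  by move=> g m m'; rewrite /GRing.comm /= -scalerAl -scalerAr mul1r mulr1.
by split.
Qed.

Lemma tensor_lift_is_linear : linear tensor_lift.
Proof.
move=> a x y; rewrite /tensor_lift raddfD /= mmapZ /=.
by rewrite -scalerAl mul1r.
Qed.

HB.instance Definition _ :=
  GRing.isLinear.Build R (tensor R n) A _ tensor_lift tensor_lift_is_linear.
HB.instance Definition _ :=
  GRing.isMonoidMorphism.Build (tensor R n) A tensor_lift
    tensor_lift_is_monoid_morphism.

End Lift.

Lemma tensor_liftE (A : algType R) (f : {linear 'cV[R]_n -> A}) v :
  tensor_lift f (tensor_vec v) = f v.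
Proof.
rewrite {2}[v]matrix_sum_delta /tensor_vec !linear_sum /=.
apply: eq_bigr => i _; rewrite big_ord1.
rewrite linearZ /tensor_lift mmapU /=.
by rewrite -scalerAl mul1r /word_lift fmU big_seq1.
Qed.

Lemma tensor_hom_ext (A : algType R) (f g : {lrmorphism tensor R n -> A}) :
  (forall v, f (tensor_vec v) = g (tensor_vec v)) -> f =1 g.
Proof.
move=> fg; have fgw (w : {fmonom 'I_n}) : f << w >> = g << w >>.
  case: w => w; elim: w => [|i w IHw].
    suff -> : << FMonom [::] >> = 1 :> tensor R n.
      by rewrite (rmorph1 f) (rmorph1 g).
    by congr << _ >>; apply/val_inj; rewrite /= fm1.
  suff -> : << FMonom (i :: w) >>
      = tensor_vec (delta_mx i 0) * << FMonom w >> :> tensor R n.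
    by rewrite (rmorphM f) (rmorphM g) /= IHw fg.
  have -> : tensor_vec (delta_mx i 0) = << fmu i >>.
    rewrite /tensor_vec (bigD1 i) //= big1 ?addr0 ?mxE ?eqxx // => j ji.
    by rewrite mxE (negPf ji) monalgU0.
  rewrite malgM_def fgmulUU mulr1; congr << _ >>.
  by apply/val_inj; rewrite /= fmM fmU.
move=> x; rewrite (monalgE x) !raddf_sum; apply: eq_bigr => w _ /=.
have -> : << x@_w *g w >> = x@_w *: (<< w >> : tensor R n).
  by rewrite -malg_scaleU mulr1.
by rewrite !linearZ /= fgw.
Qed.

End TensorAlgebra.

Section CliffordAlgebra.
Variables (R : realType) (n : nat).

Definition Phi (v : 'cV[R]_n) : R := - \sum_i v i 0 ^+ 2.

Inductive clifford_ideal : tensor R n -> Prop :=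
| clifford_ideal_gen v :
    clifford_ideal (tensor_vec v * tensor_vec v - (Phi v)%:A)
| clifford_ideal0 : clifford_ideal 0
| clifford_idealD x y :
    clifford_ideal x -> clifford_ideal y -> clifford_ideal (x + y)
| clifford_idealMl x y : clifford_ideal y -> clifford_ideal (x * y)
| clifford_idealMr x y : clifford_ideal x -> clifford_ideal (x * y).

Definition clifford_ideal_pred : {pred tensor R n} :=
  fun x => `[< clifford_ideal x >].

Lemma clifford_ideal_zmod_closed : zmod_closed clifford_ideal_pred.
Proof.
split=> [|x y /asboolP Ix /asboolP Iy]; apply/asboolP.
  exact: clifford_ideal0.
by apply: clifford_idealD => //; rewrite -mulN1r; apply: clifford_idealMl.
Qed.

HB.instance Definition _ :=
  GRing.isZmodClosed.Build (tensor R n) clifford_ideal_pred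
    clifford_ideal_zmod_closed.

Definition Cl := Quotient.quot clifford_ideal_pred.

HB.instance Definition _ := GRing.Zmodule.on Cl.
HB.instance Definition _ := EqQuotient.on Cl.

Definition cl_pi (x : tensor R n) : Cl := \pi_Cl%qT x.

Lemma cl_piP x y : cl_pi x = cl_pi y <-> clifford_ideal (x - y).
Proof.
split=> [e|I].
  apply/asboolP; change (x - y \in clifford_ideal_pred).
  by rewrite (Quotient.idealrBE clifford_ideal_pred); apply/eqP.
apply/eqP; rewrite -(Quotient.idealrBE clifford_ideal_pred).
exact/asboolP.
Qed.


Lemma cl_repr x : cl_pi (repr x) = x.
Proof. exact: reprK. Qed.

Lemma tensor_lift_ideal (A : algType R) (f : {linear 'cV[R]_n -> A}) :
  (forall v, f v * f v = (Phi v)%:A) ->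
  forall x, clifford_ideal x -> tensor_lift f x = 0.
Proof.
move=> fP x; elim=> {x} [v||x y _ IHx _ IHy|x y _ IHy|x y _ IHx].
- by rewrite raddfB /= rmorphM linearZ /= rmorph1 !tensor_liftE fP subrr.
- by rewrite raddf0.
- by rewrite raddfD /= IHx IHy addr0.
- by rewrite rmorphM /= IHy mulr0.
- by rewrite rmorphM /= IHx mul0r.
Qed.


End CliffordAlgebra.

(* A nonzero matrix representation of the Clifford relations; it shows that the
   quotient Cl is not the zero ring. *)
Lemma clifford_repr (R : realType) n :
  exists N (f : 'cV[R]_n -> 'M[R]_N.+1),
    linear f /\ forall v, f v *m f v = (Phi v)%:M.
Proof.
elim: n => [|n [N [f [lf fP]]]].
  exists 0, (fun=> 0); split=> [a u v|v]; first by rewrite scaler0 addr0.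
  by rewrite mul0mx /Phi big_ord0 oppr0 raddf0.
pose vd (v : 'cV[R]_n.+1) : 'cV[R]_n := @dsubmx R 1 n 1 v.
pose g (v : 'cV[R]_n.+1) : 'M[R]_(N.+1 + N.+1) :=
  block_mx (f (vd v)) (- (v 0 0)%:M) (v 0 0)%:M (- f (vd v)).
have lg : linear g.
  move=> a u v; rewrite /g /vd linearP lf !mxE scale_block_mx add_block_mx.
  by rewrite !raddfD /= !scalerN !scale_scalar_mx -!opprD.
have gP v : g v *m g v = (Phi v)%:M.
  rewrite /g mulmx_block !mulNmx !mulmxN opprK.
  rewrite !mul_scalar_mx !mul_mx_scalar !scale_scalar_mx fP.
  rewrite addNr subrr opprK [- _ + _]addrC -raddfB /=.
  have -> : Phi (vd v) - v 0 0 * v 0 0 = Phi v.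
    rewrite /Phi big_ord_recl opprD addrC; congr (- _ - _).
    apply: eq_bigr => i _; rewrite mxE; congr (v _ _ ^+ 2).
    exact/val_inj.
  by rewrite -scalar_mx_block.
by exists (N + N.+1)%N, g.
Qed.

Section CliffordRing.
Variables (R : realType) (n : nat).

Lemma clifford_ideal_proper : ~ clifford_ideal (1 : tensor R n).
Proof.
have [N [f [lf fP]]] := clifford_repr R n.
pose fL := GRing.isLinear.Build R 'cV[R]_n 'M[R]_N.+1 _ f lf.
pose F : {linear 'cV[R]_n -> 'M[R]_N.+1} := HB.pack f fL.
move=> /(tensor_lift_ideal (f := F)) I1.
have /eqP := I1 (fun v => etrans (fP v) (esym (scalemx1 _ _))).
by rewrite rmorph1 oner_eq0.
Qed.

Definition cl_one : Cl R n := cl_pi 1.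
Definition cl_mul (x y : Cl R n) : Cl R n := cl_pi (repr x * repr y).
Definition cl_scale (a : R) (x : Cl R n) : Cl R n := cl_pi (a *: repr x).

Lemma cl_piD : {morph @cl_pi R n : x y / x + y}.
Proof. by move=> x y; rewrite /cl_pi raddfD. Qed.

Lemma cl_piM x y : cl_pi (x * y) = cl_mul (cl_pi x) (cl_pi y).
Proof.
apply/cl_piP; set x' := repr _; set y' := repr _.
have Ix : clifford_ideal (x - x') by apply/cl_piP; rewrite cl_repr.
have Iy : clifford_ideal (y - y') by apply/cl_piP; rewrite cl_repr.
have -> : x * y - x' * y' = (x - x') * y + x' * (y - y').
  by rewrite mulrBl mulrBr addrA addrNK.
by apply: clifford_idealD; [apply: clifford_idealMr|apply: clifford_idealMl].
Qed.

Lemma cl_piZ a x : cl_pi (a *: x) = cl_scale a (cl_pi x).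
Proof.
apply/cl_piP; set x' := repr _.
have Ix : clifford_ideal (x - x') by apply/cl_piP; rewrite cl_repr.
by rewrite -scalerBr -[_ - _]mul1r scalerAl; apply: clifford_idealMl.
Qed.

Lemma cl_mulA : associative cl_mul.
Proof.
move=> x y z; rewrite -[x]cl_repr -[y]cl_repr -[z]cl_repr.
by rewrite -!cl_piM mulrA.
Qed.

Lemma cl_mul1l : left_id cl_one cl_mul.
Proof. by move=> x; rewrite -[x]cl_repr -cl_piM mul1r. Qed.

Lemma cl_mul1r : right_id cl_one cl_mul.
Proof. by move=> x; rewrite -[x]cl_repr -cl_piM mulr1. Qed.

Lemma cl_mulDl : left_distributive cl_mul +%R.
Proof.
move=> x y z; rewrite -[x]cl_repr -[y]cl_repr -[z]cl_repr.
by rewrite -cl_piD -!cl_piM mulrDl cl_piD.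
Qed.

Lemma cl_mulDr : right_distributive cl_mul +%R.
Proof.
move=> x y z; rewrite -[x]cl_repr -[y]cl_repr -[z]cl_repr.
by rewrite -cl_piD -!cl_piM mulrDr cl_piD.
Qed.

Lemma cl_one_neq0 : cl_one != 0.
Proof.
apply/eqP; rewrite -[0]cl_repr => /cl_piP I.
apply: clifford_ideal_proper; rewrite -[1](subrK (repr (0 : Cl R n))).
apply: clifford_idealD => //; rewrite -[repr _]subr0; apply/cl_piP.
by rewrite cl_repr /cl_pi raddf0.
Qed.

HB.instance Definition _ :=
  GRing.Zmodule_isNzRing.Build (Cl R n)
    cl_mulA cl_mul1l cl_mul1r cl_mulDl cl_mulDr cl_one_neq0.

Lemma cl_scaleA a b x : cl_scale a (cl_scale b x) = cl_scale (a * b) x.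
Proof. by rewrite -[x]cl_repr -!cl_piZ scalerA. Qed.

Lemma cl_scale1 : left_id 1 cl_scale.
Proof. by move=> x; rewrite -[x]cl_repr -cl_piZ scale1r. Qed.

Lemma cl_scaleDr : right_distributive cl_scale +%R.
Proof.
move=> a x y; rewrite -[x]cl_repr -[y]cl_repr.
by rewrite -cl_piD -!cl_piZ scalerDr cl_piD.
Qed.

Lemma cl_scaleDl x : {morph cl_scale^~ x : a b / a + b}.
Proof. by move=> a b; rewrite -[x]cl_repr -!cl_piZ scalerDl cl_piD. Qed.

HB.instance Definition _ :=
  GRing.Zmodule_isLmodule.Build R (Cl R n)
    cl_scaleA cl_scale1 cl_scaleDr cl_scaleDl.

Lemma cl_scaleAl (a : R) (x y : Cl R n) : a *: (x * y) = a *: x * y.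
Proof.
rewrite -[x]cl_repr -[y]cl_repr.
change (cl_scale a (cl_mul (cl_pi (repr x)) (cl_pi (repr y))) =
  cl_mul (cl_scale a (cl_pi (repr x))) (cl_pi (repr y))).
by rewrite -cl_piM -!cl_piZ -cl_piM scalerAl.
Qed.

HB.instance Definition _ :=
  GRing.Lmodule_isLalgebra.Build R (Cl R n) cl_scaleAl.

Lemma cl_scaleAr (a : R) (x y : Cl R n) : a *: (x * y) = x * (a *: y).
Proof.
rewrite -[x]cl_repr -[y]cl_repr.
change (cl_scale a (cl_mul (cl_pi (repr x)) (cl_pi (repr y))) =
  cl_mul (cl_pi (repr x)) (cl_scale a (cl_pi (repr y)))).
by rewrite -cl_piM -!cl_piZ -cl_piM scalerAr.
Qed.

HB.instance Definition _ :=
  GRing.Lalgebra_isAlgebra.Build R (Cl R n) cl_scaleAr.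

Definition cl_inverse_of (x y : Cl R n) : Prop := y * x = 1 /\ x * y = 1.
Definition cl_unit : {pred Cl R n} :=
  fun x => `[< exists y, cl_inverse_of x y >].
Definition cl_inv (x : Cl R n) : Cl R n := xget x (cl_inverse_of x).

Lemma cl_invP x : x \in cl_unit -> cl_inverse_of x (cl_inv x).
Proof. by move=> /asboolP[y xy]; apply: (xgetPex x); exists y. Qed.

Lemma cl_mulVr : {in cl_unit, left_inverse 1 cl_inv *%R}.
Proof. by move=> x /cl_invP[]. Qed.

Lemma cl_mulrV : {in cl_unit, right_inverse 1 cl_inv *%R}.
Proof. by move=> x /cl_invP[]. Qed.

Lemma cl_unitP x y : y * x = 1 /\ x * y = 1 -> cl_unit x.
Proof. by move=> xy; apply/asboolP; exists y. Qed.

Lemma cl_inv_out : {in [predC cl_unit], cl_inv =1 id}.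
Proof.
move=> x xnU; apply: xgetPN => y xy.
by case/negP: xnU; apply/asboolP; exists y.
Qed.

HB.instance Definition _ :=
  GRing.NzRing_hasMulInverse.Build (Cl R n)
    cl_mulVr cl_mulrV cl_unitP cl_inv_out.

Lemma cl_pi_is_linear : linear (@cl_pi R n).
Proof. by move=> a x y; rewrite cl_piD cl_piZ. Qed.

Lemma cl_pi_is_monoid_morphism : monoid_morphism (@cl_pi R n).
Proof. by split; [|exact: cl_piM]. Qed.

HB.instance Definition _ :=
  GRing.isLinear.Build R (tensor R n) (Cl R n) _ (@cl_pi R n) cl_pi_is_linear.
HB.instance Definition _ :=
  GRing.isMonoidMorphism.Build (tensor R n) (Cl R n) (@cl_pi R n)
    cl_pi_is_monoid_morphism.

End CliffordRing.

Section ConverseAlgebra.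
Variables (R : comNzRingType) (A : algType R).

Lemma converse_mulE (x y : A) : (x : A^c) * (y : A^c) = y * x.
Proof. by []. Qed.

HB.instance Definition _ :=
  GRing.Zmodule_isLmodule.Build R A^c
    (@scalerA R A) (@scale1r R A) (@scalerDr R A) (@scalerDl R A).

Lemma converse_scaleAl (a : R) (x y : A^c) : a *: (x * y) = a *: x * y.
Proof. exact: (@scalerAr R A a y x). Qed.

HB.instance Definition _ :=
  GRing.Lmodule_isLalgebra.Build R A^c converse_scaleAl.

Lemma converse_scaleAr (a : R) (x y : A^c) : a *: (x * y) = x * (a *: y).
Proof. exact: (@scalerAl R A a y x). Qed.

HB.instance Definition _ :=
  GRing.Lalgebra_isAlgebra.Build R A^c converse_scaleAr.

End ConverseAlgebra.

Section UniversalProperty.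
Variables (R : realType) (n : nat).

Definition cl_vec (v : 'cV[R]_n) : Cl R n := cl_pi (tensor_vec v).

Lemma cl_vec_is_linear : linear cl_vec.
Proof. by move=> a u v; rewrite /cl_vec !linearP. Qed.

HB.instance Definition _ :=
  GRing.isLinear.Build R 'cV[R]_n (Cl R n) _ cl_vec cl_vec_is_linear.

Lemma cl_vec_sqr v : cl_vec v * cl_vec v = (Phi v)%:A.
Proof.
transitivity (cl_pi (tensor_vec v * tensor_vec v)); first by rewrite rmorphM.
transitivity (cl_pi ((Phi v)%:A : tensor R n)).
  exact/cl_piP/clifford_ideal_gen.
by rewrite linearZ rmorph1.
Qed.

Lemma cl_vec_inj : injective cl_vec.
Proof.
move=> u v /eqP; rewrite -subr_eq0 -raddfB => /eqP uv0.
apply/eqP; rewrite -subr_eq0; set w := u - v in uv0 *.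
have /eqP := cl_vec_sqr w; rewrite uv0 mul0r eq_sym scaler_eq0 oner_eq0 orbF.
rewrite oppr_eq0 psumr_eq0 => [/allP w0|i _]; last exact: sqr_ge0.
apply/eqP/colP => i; rewrite [RHS]mxE; apply/eqP.
by have := w0 i; rewrite mem_index_enum sqrf_eq0; apply.
Qed.

Section Lift.
Variables (A : algType R) (f : {linear 'cV[R]_n -> A}).
Hypothesis fP : forall v, f v * f v = (Phi v)%:A.

Definition cl_lift (x : Cl R n) : A := tensor_lift f (repr x).

Lemma cl_lift_pi x : cl_lift (cl_pi x) = tensor_lift f x.
Proof.
apply/eqP; rewrite -subr_eq0 -raddfB /=; apply/eqP.
by apply: (tensor_lift_ideal fP); apply/cl_piP; rewrite cl_repr.
Qed.

Lemma cl_lift_vec v : cl_lift (cl_vec v) = f v.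
Proof. by rewrite cl_lift_pi tensor_liftE. Qed.

Lemma cl_lift_is_linear : linear cl_lift.
Proof.
move=> a x y; rewrite -[x]cl_repr -[y]cl_repr -linearP !cl_lift_pi.
by rewrite linearP.
Qed.

Lemma cl_lift_is_monoid_morphism : monoid_morphism cl_lift.
Proof.
split; first by rewrite (cl_lift_pi 1) rmorph1.
move=> x y; rewrite -[x]cl_repr -[y]cl_repr -rmorphM !cl_lift_pi.
by rewrite rmorphM.
Qed.

End Lift.

Lemma cl_hom_ext (A : algType R) (f g : {lrmorphism Cl R n -> A}) :
  (forall v, f (cl_vec v) = g (cl_vec v)) -> f =1 g.
Proof.
move=> fg x; rewrite -[x]cl_repr.
exact: (@tensor_hom_ext R n A (f \o @cl_pi R n) (g \o @cl_pi R n)).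
Qed.

End UniversalProperty.

Section CliffordGroup.
Variables (R : realType) (n : nat).
Implicit Types (x y : Cl R n) (v w : 'cV[R]_n).

Definition cl_alpha : Cl R n -> Cl R n := cl_lift (-%R \o @cl_vec R n).

Lemma cl_opp_vec_sqr v :
  (-%R \o @cl_vec R n) v * (-%R \o @cl_vec R n) v = (Phi v)%:A.
Proof. by rewrite /= mulrNN cl_vec_sqr. Qed.

HB.instance Definition _ :=
  GRing.isLinear.Build R (Cl R n) (Cl R n) _ cl_alpha
    (cl_lift_is_linear cl_opp_vec_sqr).
HB.instance Definition _ :=
  GRing.isMonoidMorphism.Build (Cl R n) (Cl R n) cl_alpha
    (cl_lift_is_monoid_morphism cl_opp_vec_sqr).

Lemma cl_alpha_vec v : cl_alpha (cl_vec v) = - cl_vec v.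
Proof. exact: (cl_lift_vec cl_opp_vec_sqr). Qed.

Lemma cl_alphaK : involutive cl_alpha.
Proof.
apply: (@cl_hom_ext R n (Cl R n) (cl_alpha \o cl_alpha) idfun) => v /=.
by rewrite !cl_alpha_vec raddfN /= cl_alpha_vec opprK.
Qed.

(* An anti-automorphism is a morphism into the converse algebra. *)
Definition cl_vec_conv (v : 'cV[R]_n) : (Cl R n)^c := cl_vec v.

HB.instance Definition _ :=
  GRing.isLinear.Build R 'cV[R]_n (Cl R n)^c _ cl_vec_conv
    (@cl_vec_is_linear R n).

Definition cl_t : Cl R n -> Cl R n := cl_lift cl_vec_conv.

Let cl_vec_conv_sqr v : cl_vec_conv v * cl_vec_conv v = (Phi v)%:A.
Proof. exact: cl_vec_sqr. Qed.

HB.instance Definition _ :=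
  GRing.isLinear.Build R (Cl R n) (Cl R n) _ cl_t
    (cl_lift_is_linear cl_vec_conv_sqr).

Lemma cl_t_vec v : cl_t (cl_vec v) = cl_vec v.
Proof. exact: (cl_lift_vec cl_vec_conv_sqr). Qed.

Lemma cl_t1 : cl_t 1 = 1.
Proof. exact: (cl_lift_is_monoid_morphism cl_vec_conv_sqr).1. Qed.

Lemma cl_tM x y : cl_t (x * y) = cl_t y * cl_t x.
Proof.
rewrite -[RHS](converse_mulE (cl_t x) (cl_t y)).
by rewrite /cl_t (cl_lift_is_monoid_morphism cl_vec_conv_sqr).2.
Qed.

Lemma cl_tK : involutive cl_t.
Proof.
pose f := cl_t \o cl_t.
have f1 : monoid_morphism f.
  by split=> [|x y]; rewrite /f /= ?cl_t1 // !cl_tM.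
pose fM := GRing.isMonoidMorphism.Build (Cl R n) (Cl R n) f f1.
pose F : {lrmorphism Cl R n -> Cl R n} := HB.pack f fM.
by apply: (@cl_hom_ext R n (Cl R n) F idfun) => v; rewrite /= /f /= !cl_t_vec.
Qed.

Lemma cl_t_unique (f : {linear Cl R n -> Cl R n}) :
  f 1 = 1 -> (forall x y, f (x * y) = f y * f x) ->
  (forall v, f (cl_vec v) = cl_vec v) -> f =1 cl_t.
Proof.
move=> f1 fM fv.
pose to_conv (g : Cl R n -> Cl R n) : Cl R n -> (Cl R n)^c := g.
have pack (g : {linear Cl R n -> Cl R n}) :
    g 1 = 1 -> (forall x y, g (x * y) = g y * g x) ->
    {h : {lrmorphism Cl R n -> (Cl R n)^c} | h =1 to_conv g}.
  move=> g1 gM.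
  pose gL := GRing.isLinear.Build R (Cl R n) (Cl R n)^c _ (to_conv g)
    (@linearP _ _ _ _ g).
  pose gR := GRing.isMonoidMorphism.Build (Cl R n) (Cl R n)^c (to_conv g)
    (pair g1 gM).
  pose G : {lrmorphism Cl R n -> (Cl R n)^c} := HB.pack (to_conv g) gL gR.
  by exists G.
have [F Ff] := pack f f1 fM; have [T Tt] := pack cl_t cl_t1 cl_tM.
have FT v : F (cl_vec v) = T (cl_vec v).
  by rewrite Ff Tt /to_conv /= fv cl_t_vec.
by move=> x; have := cl_hom_ext FT x; rewrite Ff Tt.
Qed.

Definition cl_bar x : Cl R n := cl_t (cl_alpha x).
Definition cl_norm x : Cl R n := x * cl_bar x.

Definition Cl_even : set (Cl R n) := [set x | cl_alpha x = x].

Definition Gamma : set (Cl R n) :=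
  [set x | x \is a GRing.unit /\
    forall v, exists w, cl_alpha x * cl_vec v * x^-1 = cl_vec w].

Definition Gamma_even : set (Cl R n) := Gamma `&` Cl_even.

(* rho x is the matrix, in the standard basis and acting on column vectors, of
   v |-> alpha(x) v x^-1; it is meaningful only for x in Gamma, see rhoE. *)
Definition rho_vec x v : 'cV[R]_n :=
  xget 0 [set w | cl_alpha x * cl_vec v * x^-1 = cl_vec w].

Definition rho x : 'M[R]_n := \matrix_(i, j) rho_vec x (delta_mx j 0) i 0.

Lemma rhoE x v :
  Gamma x -> cl_vec (rho x *m v) = cl_alpha x * cl_vec v * x^-1.
Proof.
case=> _ xG.
have rvE w : cl_vec (rho_vec x w) = cl_alpha x * cl_vec w * x^-1.
  by have [u uE] := xG w; rewrite /rho_vec; case: xgetP => [_ _ <- //|/(_ u)].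
have -> : rho x *m v = \sum_j v j 0 *: rho_vec x (delta_mx j 0).
  apply/colP => i; rewrite !mxE summxE; apply: eq_bigr => j _.
  by rewrite !mxE mulrC.
rewrite linear_sum [v in RHS]matrix_sum_delta linear_sum /=.
rewrite mulr_sumr mulr_suml; apply: eq_bigr => j _.
by rewrite big_ord1 !linearZ /= rvE -scalerAr -scalerAl.
Qed.

Definition Pin : set (Cl R n) := [set x | Gamma x /\ cl_norm x = 1].
Definition Spin : set (Cl R n) := Pin `&` Gamma_even.

Definition Orthogonal : set 'M[R]_n := [set A | A^T *m A = 1%:M].
Definition SpecialOrthogonal : set 'M[R]_n :=
  [set A | Orthogonal A /\ \det A = 1].

End CliffordGroup.

Arguments Pin : clear implicits.
Arguments Spin : clear implicits.
Arguments Orthogonal : clear implicits.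
Arguments SpecialOrthogonal : clear implicits.

(* A subset of a ring that is a group for the ring multiplication and 1. *)
Definition is_mulgroup (A : pzRingType) (G : set A) : Prop :=
  [/\ G 1, forall x y, G x -> G y -> G (x * y)
    & forall x, G x -> exists y, [/\ G y, x * y = 1 & y * x = 1]].

Definition is_group_hom (A B : pzRingType) (G : set A) (H : set B)
    (f : A -> B) : Prop :=
  [/\ is_mulgroup G, is_mulgroup H, forall x, G x -> H (f x)
    & forall x y, G x -> G y -> f (x * y) = f x * f y].

Definition hom_ker (A B : pzRingType) (G : set A) (f : A -> B) : set A :=
  [set x | G x /\ f x = 1].

(* Main.v *)
(* A unit vector u lies in Pin(n) and rho(u) is the reflection along u.  Every
   orthogonal matrix A is a product of reflections, so it lifts to a product x of
   unit vectors, for which alpha(x) = det(A) x.  If rho(x) = 1, then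
   alpha(x) v = v x for all v, which removes the generators e_1, ..., e_n from x
   one by one; so x is a scalar, and N(x) = 1 gives x = 1 or x = -1.  Hence every
   x in Pin(n) satisfies alpha(x) = det(rho(x)) x, so x is even exactly when
   rho(x) has determinant 1. *)
Require Import Defs.
From mathcomp Require Import all_boot all_order all_algebra.
From mathcomp Require Import boolp classical_sets reals.
From mathcomp Require Import finmap monalg ring.

Import Order.TTheory GRing.Theory Num.Theory.
Local Open Scope classical_set_scope.
Local Open Scope ring_scope.

(** * Linear algebra and ring identities *)

(** Both [M *m E] and [E *m M] are block lower triangular, with diagonal blocks [1], [1 - u v] and
    [1 - v u], [1] respectively; their determinants agree. *)
Lemma det_rank1_update (R : comNzRingType) n (u : 'cV[R]_n) (v : 'rV[R]_n) :
  \det (1%:M - u *m v) = 1 - (v *m u) 0 0.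
Proof.
pose M : 'M[R]_(1 + n) := block_mx 1%:M v u 1%:M.
pose E : 'M[R]_(1 + n) := block_mx 1%:M (- v) 0 1%:M.
have detE : \det E = 1 by rewrite det_ublock !det1 mulr1.
transitivity (\det (M *m E)).
  rewrite mulmx_block !mulmx1 !mulmx0 !addr0 mul1mx addNr mulmxN addrC.
  by rewrite det_lblock det1 mul1r addrC.
rewrite det_mulmx mulrC -det_mulmx mulmx_block !mul1mx !mul0mx !add0r mulmx1.
by rewrite subrr mulNmx det_lblock det1 mulr1 det_mx11 !mxE.
Qed.

Lemma eq_mulmx_col (R : pzSemiRingType) m n (A B : 'M[R]_(m, n)) :
  (forall v : 'cV_n, A *m v = B *m v) -> A = B.
Proof.
move=> AB; apply/matrixP => i j.
by have /matrixP/(_ i 0) := AB (delta_mx j 0); rewrite -!colE !mxE.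
Qed.

Lemma sqr_polarization {A : pzRingType} (a b : A) :
  a * b + b * a = (a + b) * (a + b) - a * a - b * b.
Proof.
by rewrite mulrDl !mulrDr addrAC addrA addrK -!addrA addrC addrA subrK.
Qed.

(** * The standard scalar product *)

Section Dot.
Set Implicit Arguments.
Unset Strict Implicit.
Variables (R : realType) (n : nat).
Implicit Types (u v w : 'cV[R]_n) (A B : 'M[R]_n).

Definition dot u v : R := (u^T *m v) 0 0.

Lemma dotE u v : dot u v = \sum_i u i 0 * v i 0.
Proof. by rewrite /dot mxE; apply: eq_bigr => i _; rewrite mxE. Qed.

Lemma dotC u v : dot u v = dot v u.
Proof. by rewrite !dotE; apply: eq_bigr => i _; rewrite mulrC. Qed.

Lemma dotDl u v w : dot (u + v) w = dot u w + dot v w.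
Proof. by rewrite /dot linearD mulmxDl mxE. Qed.

Lemma dotDr u v w : dot u (v + w) = dot u v + dot u w.
Proof. by rewrite /dot mulmxDr mxE. Qed.

Lemma dotBl u v w : dot (u - v) w = dot u w - dot v w.
Proof. by rewrite /dot linearB mulmxBl !mxE. Qed.

Lemma dotBr u v w : dot u (v - w) = dot u v - dot u w.
Proof. by rewrite /dot mulmxBr !mxE. Qed.

Lemma dotZl a u v : dot (a *: u) v = a * dot u v.
Proof. by rewrite /dot linearZ /= -scalemxAl mxE. Qed.

Lemma dotZr a u v : dot u (a *: v) = a * dot u v.
Proof. by rewrite dotC dotZl dotC. Qed.

Lemma dot_ge0 v : 0 <= dot v v.
Proof. by rewrite dotE; apply: sumr_ge0 => i _; apply: sqr_ge0. Qed.

Lemma dot_eq0 v : dot v v = 0 -> v = 0.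
Proof.
rewrite dotE => /eqP; rewrite psumr_eq0 => [/allP v0|i _]; last exact: sqr_ge0.
apply/colP => i; rewrite mxE; apply/eqP.
by have := v0 i; rewrite mem_index_enum mulf_eq0 orbb; apply.
Qed.

Lemma dot_delta (A B : 'M[R]_n) i j :
  dot (A *m delta_mx i 0) (B *m delta_mx j 0) = (A^T *m B) i j.
Proof. by rewrite -!colE dotE mxE; apply: eq_bigr => k _; rewrite !mxE. Qed.

Lemma dot_basis i j : dot (delta_mx i 0) (delta_mx j 0) = (i == j)%:R.
Proof.
rewrite -[delta_mx i 0]mul1mx -[delta_mx j 0]mul1mx dot_delta.
by rewrite trmx1 mulmx1 mxE.
Qed.

Lemma dot_Orthogonal A u v :
  Orthogonal R n A -> dot (A *m u) (A *m v) = dot u v.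
Proof.
by move=> OA; rewrite /dot trmx_mul mulmxA -[_ *m A]mulmxA OA mulmx1.
Qed.

Lemma Phi_dot v : Phi v = - dot v v.
Proof. by rewrite dotE. Qed.

End Dot.

(* [C] stands for [Cl R n]: with the concrete quotient, unification and trivial
   goals may unfold down to the free monoid algebra and do not terminate in
   practice. *)
Section AbstractClifford.
Set Implicit Arguments.
Unset Strict Implicit.
Variables (R : realType) (n : nat) (C : unitAlgType R).
Variable vec : {linear 'cV[R]_n -> C}.
Implicit Types (x y : C) (u v w : 'cV[R]_n) (A B : 'M[R]_n).

Definition gen (i : 'I_n) : C := vec (delta_mx i 0).

(** The unital subalgebra generated by the [gen i] with [k <= i], spanned by words grown on the
    left: the whole algebra for [k = 0], only the scalars for [k = n]. *)
Inductive tail_algebra (k : nat) : C -> Prop :=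
| tail_algebra1 : tail_algebra k 1
| tail_algebraP a x y :
    tail_algebra k x -> tail_algebra k y -> tail_algebra k (a *: x + y)
| tail_algebraM (i : 'I_n) x :
    (k <= i)%N -> tail_algebra k x -> tail_algebra k (gen i * x).

Hypothesis tail_algebra_all : forall x, tail_algebra 0 x.

Variables (alpha : {lrmorphism C -> C}) (t : {linear C -> C}).
Hypotheses (vec_sqr : forall v, vec v * vec v = (Phi v)%:A)
  (alpha_vec : forall v, alpha (vec v) = - vec v) (alphaK : involutive alpha)
  (t_vec : forall v, t (vec v) = vec v) (t1 : t 1 = 1)
  (tM : forall x y, t (x * y) = t y * t x) (tK : involutive t).

Variables (G : set C) (rho : C -> 'M[R]_n).
Hypothesis GP : forall x, G x <->
  x \is a GRing.unit /\ forall v, exists w, alpha x * vec v * x^-1 = vec w.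
Hypothesis vec_inj : injective vec.
Hypothesis rhoE : forall x v, G x -> vec (rho x *m v) = alpha x * vec v * x^-1.

Definition bar x : C := t (alpha x).
Definition pin : set C := [set x | G x /\ x * bar x = 1].
Definition spin : set C := pin `&` (G `&` [set x | alpha x = x]).

(** * Clifford relations and conjugation *)

Lemma scalar_inj : injective (fun a : R => a%:A : C).
Proof.
move=> a b /eqP; rewrite -subr_eq0 -scalerBl scaler_eq0 oner_eq0 orbF subr_eq0.
by move/eqP.
Qed.

(** Polarization of [vec_sqr]: the squares of [u + v], [u] and [v] are scalars. *)
Lemma vec_anticomm u v :
  vec u * vec v + vec v * vec u = (- (dot u v *+ 2))%:A.
Proof.
rewrite sqr_polarization -raddfD !vec_sqr -!scalerBl !Phi_dot.
rewrite dotDl !dotDr (dotC v u); congr (_%:A); ring.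
Qed.

Lemma tail_algebra0 k : tail_algebra k 0.
Proof.
have -> : 0 = - 1 *: 1 + 1 :> C by rewrite scaleN1r addNr.
by apply: tail_algebraP; exact: tail_algebra1.
Qed.

Lemma tail_algebraN k x : tail_algebra k x -> tail_algebra k (- x).
Proof.
move=> Sx; rewrite -[- x]addr0 -scaleN1r.
by apply: tail_algebraP => //; exact: tail_algebra0.
Qed.

Lemma gen_sqr i : gen i * gen i = -1.
Proof. by rewrite vec_sqr Phi_dot dot_basis eqxx scaleN1r. Qed.

Lemma gen_anticomm i j : i != j -> gen i * gen j = - (gen j * gen i).
Proof.
move=> ij; apply/eqP; rewrite -addr_eq0 vec_anticomm.
by rewrite dot_basis (negPf ij) mul0rn oppr0 scale0r.
Qed.

(** Both sides reverse products and send [vec v] to [- vec v], so induction over words applies. *)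
Lemma alpha_t x : alpha (t x) = t (alpha x).
Proof.
elim: (tail_algebra_all x) => {x} [|a x y _ IHx _ IHy|i x _ _ IHx].
- by rewrite t1 rmorph1 t1.
- by rewrite !linearP /= IHx IHy.
by rewrite tM !rmorphM /= tM IHx t_vec alpha_vec raddfN /= t_vec.
Qed.

Lemma barM : {morph bar : x y / x * y >-> y * x}.
Proof. by move=> x y; rewrite /bar rmorphM tM. Qed.

Lemma barA (a : R) : bar a%:A = a%:A.
Proof. by rewrite /bar linearZ /= rmorph1 linearZ /= t1. Qed.

Lemma bar_vec v : bar (vec v) = - vec v.
Proof. by rewrite /bar alpha_vec raddfN /= t_vec. Qed.

Lemma barK : involutive bar.
Proof. by move=> x; rewrite /bar alpha_t tK alphaK. Qed.

Lemma bar_alpha x : bar (alpha x) = alpha (bar x).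
Proof. by rewrite /bar alpha_t. Qed.

(** * The Clifford group, the pinor group and the action on vectors *)

Lemma G_unit x : G x -> x \is a GRing.unit.
Proof. by move=> /GP[]. Qed.

Lemma pin_unit x : pin x -> x \is a GRing.unit.
Proof. by case=> /G_unit. Qed.

Lemma pin_bar x : pin x -> bar x = x^-1.
Proof.
by move=> Px; apply: (mulrI (pin_unit Px)); rewrite mulrV ?pin_unit ?Px.2.
Qed.

Lemma rho_unique x A :
  G x -> (forall v, alpha x * vec v * x^-1 = vec (A *m v)) -> rho x = A.
Proof.
move=> Gx xA; apply: eq_mulmx_col => v; apply: vec_inj.
by rewrite rhoE ?xA.
Qed.

(** Multiplying two formulas for the action, [alpha x * vec u * x^-1] and
    [x * vec v * (alpha x)^-1], shows that products of two vectors are conjugated by [alpha x].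
    Anticommutators of vectors are scalars, hence unchanged, and they determine the scalar
    product. *)
Lemma rho_Orthogonal x : pin x -> Orthogonal R n (rho x).
Proof.
move=> Px; have xU := pin_unit Px; have aU := rmorph_unit alpha xU.
have [Gx _] := Px.
(* The second formula is [bar] applied to the first: [bar] negates vectors, reverses products and
   inverts [x]. *)
have rho_conj v : vec (rho x *m v) = x * vec v * (alpha x)^-1.
  apply: oppr_inj; rewrite -bar_vec rhoE // !barM bar_alpha.
  rewrite -(pin_bar Px) barK bar_vec (pin_bar Px) rmorphV //.
  by rewrite mulNr mulrN mulrA.
have rho_mul u v : vec (rho x *m u) * vec (rho x *m v) =
    alpha x * (vec u * vec v) * (alpha x)^-1.
  by rewrite rhoE // rho_conj !mulrA mulrVK.
have rho_dot u v : dot (rho x *m u) (rho x *m v) = dot u v.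
  have := vec_anticomm (rho x *m u) (rho x *m v).
  rewrite !rho_mul -mulrDl -mulrDr vec_anticomm.
  rewrite -scalerAr mulr1 -scalerAl mulrV // => /scalar_inj /oppr_inj /eqP.
  by rewrite eqrMn2r //= => /eqP.
apply/matrixP => i j; rewrite -dot_delta rho_dot.
by rewrite dot_basis mxE.
Qed.

Lemma G1 : G (1 : C).
Proof.
apply/GP; split=> [|v]; first exact: unitr1.
by exists v; rewrite rmorph1 mul1r invr1 mulr1.
Qed.

Lemma GM x y : G x -> G y -> G (x * y).
Proof.
move=> Gx Gy; have xU := G_unit Gx; have yU := G_unit Gy.
apply/GP; split=> [|v]; first by rewrite unitrMl.
exists (rho x *m (rho y *m v)).
by rewrite rhoE // rhoE // invrM // rmorphM /= !mulrA.
Qed.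

Lemma rhoM x y : G x -> G y -> rho (x * y) = rho x *m rho y.
Proof.
move=> Gx Gy; have xU := G_unit Gx; have yU := G_unit Gy.
apply: rho_unique => [|v]; first exact: GM.
by rewrite -mulmxA rhoE // rhoE // invrM // rmorphM /= !mulrA.
Qed.

Lemma rho_pinM x y : pin x -> pin y -> rho (x * y) = rho x *m rho y.
Proof. by move=> [Gx _] [Gy _]; exact: rhoM. Qed.

Lemma rho1 : rho (1 : C) = 1%:M.
Proof.
apply: rho_unique => [|v]; first exact: G1.
by rewrite rmorph1 mul1r invr1 mulr1 mul1mx.
Qed.

Lemma pin1 : pin 1.
Proof.
split; first exact: G1.
by rewrite /bar rmorph1 t1 mulr1.
Qed.

Lemma pinM x y : pin x -> pin y -> pin (x * y).
Proof.
move=> [Gx Nx] [Gy Ny]; split; first exact: GM.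
rewrite barM mulrA -[x * y * _]mulrA.
have -> : y * bar y = 1 by exact: Ny.
by rewrite mulr1; exact: Nx.
Qed.

Lemma pinV x : pin x -> pin x^-1.
Proof.
move=> Px; have xU := pin_unit Px; have [Gx _] := Px; split; last first.
  by rewrite -(pin_bar Px) barK (pin_bar Px) mulVr.
apply/GP; split=> [|v]; first by rewrite unitrV.
(* The transpose inverts the orthogonal matrix [rho x], so [v] is the image of this witness under
   [rho x]. *)
exists ((rho x)^T *m v).
have {1}-> : v = rho x *m ((rho x)^T *m v).
  by rewrite mulmxA (mulmx1C (rho_Orthogonal Px)) mul1mx.
by rewrite rhoE // invrK !mulrA -rmorphM /= mulVr // rmorph1 mul1r mulrVK.
Qed.

Lemma pinN x : pin x -> pin (- x).
Proof.
move=> [/GP[xU xG] Nx]; split.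
  apply/GP; split=> [|v]; first by rewrite unitrN.
  by have [w wE] := xG v; exists w; rewrite raddfN /= invrN mulrN !mulNr opprK.
rewrite /bar [alpha _]raddfN [t _]raddfN mulrNN; exact: Nx.
Qed.

Lemma rhoN x : pin x -> rho (- x) = rho x.
Proof.
move=> Px; have [Gx _] := Px; have [Gnx _] := pinN Px.
apply: rho_unique => // v.
by rewrite rhoE // raddfN /= invrN mulrN !mulNr opprK.
Qed.

Lemma is_mulgroup_pin : is_mulgroup pin.
Proof.
split; [exact: pin1|exact: pinM|move=> x Px; exists x^-1].
by split; [exact: pinV|rewrite mulrV ?pin_unit|rewrite mulVr ?pin_unit].
Qed.

Lemma is_mulgroup_Orthogonal : is_mulgroup (Orthogonal R n).
Proof.
rewrite /Orthogonal; split=> [|A B /= OA OB|A /= OA].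
- by rewrite /= trmx1 mulmx1.
- by rewrite trmx_mul mulmxA -[_ *m A]mulmxA OA mulmx1.
by exists A^T; rewrite trmxK; split; [exact: mulmx1C|exact: mulmx1C|].
Qed.

(** * The kernel of the action *)

(** Since [gen i] anticommutes with the later generators and squares to -1, all its occurrences in a
    word can be moved to the front and reduced to at most one. *)
Lemma tail_algebra_split (i : 'I_n) x : tail_algebra i x ->
  exists a b, [/\ tail_algebra i.+1 a, tail_algebra i.+1 b & x = a + gen i * b].
Proof.
elim=> {x} [|c x y _ [a [b [Sa Sb ->]]] _ [a' [b' [Sa' Sb' ->]]]
           |j x ij _ [a [b [Sa Sb ->]]]].
- exists 1, 0; rewrite mulr0 addr0.
  by split; [exact: tail_algebra1|exact: tail_algebra0|].
- exists (c *: a + a'), (c *: b + b'); split; [exact: tail_algebraP..|].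
  by rewrite scalerDr mulrDr scalerAr addrACA.
have [eij|nij] := eqVneq i j.
  exists (- b), a; split => //; first exact: tail_algebraN.
  by rewrite -eij mulrDr mulrA gen_sqr mulN1r addrC.
have lij : (i < j)%N by rewrite ltn_neqAle ij andbT.
exists (gen j * a), (- (gen j * b)).
split; [exact: tail_algebraM|apply: tail_algebraN; exact: tail_algebraM|].
by rewrite mulrDr !mulrA gen_anticomm 1?eq_sym // mulrN mulNr mulrA.
Qed.

(** Moving [gen i] past a later generator costs a sign, and [alpha] contributes the same sign for
    each generator, so the signs cancel. *)
Lemma tail_algebra_twist (i : 'I_n) k x : (i < k)%N -> tail_algebra k x ->
  alpha x * gen i = gen i * x.
Proof.
move=> ik; elim=> {x} [|c x y _ IHx _ IHy|j x kj _ IHx].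
- by rewrite rmorph1 mulr1 mul1r.
- by rewrite linearP mulrDl mulrDr -scalerAl -scalerAr IHx IHy.
rewrite rmorphM /= alpha_vec -mulrA IHx mulNr mulrA.
rewrite gen_anticomm ?mulNr ?opprK ?mulrA //.
by rewrite -val_eqE neq_ltn (leq_trans ik kj) ?orbT.
Qed.

(* Writing x = a + e_k b with a, b free of e_k, the relation
   alpha(x) e_k = e_k x becomes e_k a + b = e_k a - b, so that b = 0. *)
Lemma tail_algebraS (i : 'I_n) x : tail_algebra i x ->
  alpha x * gen i = gen i * x -> tail_algebra i.+1 x.
Proof.
move=> /tail_algebra_split[a [b [Sa Sb ->]]].
rewrite raddfD /= rmorphM /= alpha_vec mulrDl mulrDr -mulrA.
rewrite !(tail_algebra_twist (ltnSn i)) // => /addrI /eqP.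
rewrite mulNr mulrA gen_sqr mulN1r opprK -subr_eq0 opprK -mulr2n -scaler_nat.
rewrite scaler_eq0 pnatr_eq0 /= => /eqP ->.
by rewrite mulr0 addr0.
Qed.

Lemma tail_algebra_scalar x : tail_algebra n x -> exists a : R, x = a%:A.
Proof.
elim=> {x} [|c x y _ [a ->] _ [b ->]|i x]; first by exists 1; rewrite scale1r.
  by exists (c * a + b); rewrite scalerA scalerDl.
by rewrite leqNgt ltn_ord.
Qed.

(** Induction on [k]: the hypothesis at the basis vector of index [k] moves [x] from
    [tail_algebra k] to [tail_algebra k.+1], until only scalars remain. *)
Lemma twisted_center_scalar x :
  (forall v, alpha x * vec v = vec v * x) -> exists a : R, x = a%:A.
Proof.
move=> xC; apply: tail_algebra_scalar.
suff S k : (k <= n)%N -> tail_algebra k x by exact: S.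
elim: k => [_|k IHk kn]; first exact: tail_algebra_all.
exact: (@tail_algebraS (Ordinal kn) x (IHk (ltnW kn)) (xC _)).
Qed.

Lemma hom_ker_pin : hom_ker pin rho = [set -1; 1].
Proof.
apply/seteqP; split=> [x [Px rx1]|x [|] -> /=].
- have xU := pin_unit Px; have [Gx Nx] := Px.
  have [v|a xE] := @twisted_center_scalar x.
    have := rhoE v Gx; rewrite (rx1 : rho x = 1%:M) mul1mx.
    by move=> /esym /(canRL (mulrVK xU)).
  (* Conjugation fixes scalars, so the norm of [a%:A] is the square of [a]. *)
  move: Nx; rewrite xE barA -scalerAl mul1r scalerA.
  rewrite -[RHS](scale1r 1) => /scalar_inj /eqP; rewrite -expr2 sqrf_eq1.
  by case/orP=> /eqP ->; [right; rewrite scale1r|left; rewrite scaleN1r].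
- by split; [apply: pinN; exact: pin1|rewrite rhoN ?rho1 //; exact: pin1].
by split; [exact: pin1|exact: rho1].
Qed.

(** * Reflections and the lifting of orthogonal matrices *)

(** For a unit vector [u], the orthogonal reflection in the hyperplane normal to [u]. The rank-one
    form is the one that [det_rank1_update] evaluates. *)
Definition reflection u : 'M[R]_n := 1%:M - (2 *: u) *m u^T.

Lemma reflectionE u v : reflection u *m v = v - (dot u v *+ 2) *: u.
Proof.
rewrite mulmxBl mul1mx -mulmxA [u^T *m v]mx11_scalar mul_mx_scalar scalerA.
by rewrite mulr_natr.
Qed.

Lemma det_reflection u : dot u u = 1 -> \det (reflection u) = -1.
Proof.
move=> u1; rewrite det_rank1_update -scalemxAr mxE -/(dot u u) u1; ring.
Qed.

Section UnitVector.
Variable u : 'cV[R]_n.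
Hypothesis u1 : dot u u = 1.

Lemma unit_vec_sqr : vec u * vec u = -1.
Proof. by rewrite vec_sqr Phi_dot u1 scaleN1r. Qed.

Lemma unit_vec_unit : vec u \is a GRing.unit.
Proof.
by apply/unitrP; exists (- vec u); rewrite mulNr mulrN unit_vec_sqr opprK.
Qed.

Lemma unit_vec_inv : (vec u)^-1 = - vec u.
Proof.
by apply: (mulrI unit_vec_unit); rewrite mulrV ?unit_vec_unit // mulrN
  unit_vec_sqr opprK.
Qed.

(** The left side is u v u; anticommuting the first two factors and using u u = -1 leaves v - 2 (u .
    v) u. *)
Lemma unit_vec_twist v :
  alpha (vec u) * vec v * (vec u)^-1 = vec (reflection u *m v).
Proof.
rewrite unit_vec_inv alpha_vec reflectionE mulrN !mulNr opprK.
have /(canRL (addrK _)) -> := vec_anticomm u v.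
rewrite mulrBl -mulrA unit_vec_sqr mulrN1 opprK -scalerAl mul1r.
by rewrite linearB linearZ /= addrC scaleNr.
Qed.

Lemma pin_unit_vec : pin (vec u).
Proof.
split; last by rewrite bar_vec mulrN unit_vec_sqr opprK.
apply/GP; split=> [|v]; first exact: unit_vec_unit.
by exists (reflection u *m v); exact: unit_vec_twist.
Qed.

Lemma rho_unit_vec : rho (vec u) = reflection u.
Proof. by apply: rho_unique unit_vec_twist; case: pin_unit_vec. Qed.

End UnitVector.

Lemma reflection_Orthogonal u : dot u u = 1 -> Orthogonal R n (reflection u).
Proof.
by move=> u1; rewrite -rho_unit_vec //; exact/rho_Orthogonal/pin_unit_vec.
Qed.

Lemma reflectionK u v : dot u u = 1 -> reflection u *m (reflection u *m v) = v.
Proof.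
move=> u1; rewrite !reflectionE dotBr dotZr u1 mulr1 -addrA -opprD -scalerDl.
by rewrite mulr2n [X in X *: u](_ : _ = 0) ?scale0r ?subr0 //; ring.
Qed.

(* The reflection is the one along w - v. *)
Lemma reflection_swap v w : dot v v = dot w w -> w != v ->
  exists u, [/\ dot u u = 1, reflection u *m w = v &
    forall z, dot z w = dot z v -> reflection u *m z = z].
Proof.
move=> vw wv; pose d := w - v; pose q := dot d d.
have q0 : 0 < q.
  rewrite lt_def dot_ge0 andbT; apply: contra wv => /eqP /dot_eq0 /eqP.
  by rewrite subr_eq0.
(* This factor normalizes [d] to a unit vector. *)
pose c := (Num.sqrt q)^-1.
have cq : c * c * q = 1.
  by rewrite -expr2 exprVn sqr_sqrtr ?ltW // mulVf // gt_eqF.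
exists (c *: d); split.
- by rewrite dotZl dotZr mulrA.
- rewrite reflectionE dotZl scalerA.
  (* As [v] and [w] have equal length, [dot d d] is twice [dot d w]; the coefficient of [d] is
     therefore [c * c * q], which is 1. *)
  suff -> : c * dot d w *+ 2 * c = 1 by rewrite scale1r /d subKr.
  rewrite -cq /q /d !dotBl !dotBr vw (dotC v w); ring.
move=> z zE.
by rewrite reflectionE dotZl dotC /d dotBr zE subrr mulr0 mul0rn scale0r subr0.
Qed.

(* Cartan-Dieudonne: composing with one reflection makes A fix one more basis
   vector. *)
Lemma rho_lift_fixing k A : (k <= n)%N -> Orthogonal R n A ->
  (forall i : 'I_n, (i < n - k)%N ->
    A *m delta_mx i 0 = delta_mx i 0 :> 'cV_n) ->
  exists x, [/\ pin x, rho x = A & alpha x = \det A *: x].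
Proof.
elim: k A => [|k IHk] A kn OA Afix.
  exists 1; have -> : A = 1%:M.
    apply/matrixP => i j; have := Afix j; rewrite subn0 ltn_ord => /(_ isT).
    by rewrite -colE => /matrixP/(_ i 0); rewrite !mxE eqxx andbT.
  by split; [exact: pin1|exact: rho1|rewrite det1 scale1r rmorph1].
have jn : (n - k.+1 < n)%N by rewrite ltn_subrL (leq_trans _ kn).
(* With [k.+1] in place of [k], the basis vectors of index below [n - k.+1] are fixed, so [j] is the
   next one to fix. *)
pose j := Ordinal jn.
have fix_step B : (forall i : 'I_n, (i < n - k.+1)%N ->
      B *m delta_mx i 0 = delta_mx i 0 :> 'cV_n) ->
    B *m delta_mx j 0 = delta_mx j 0 :> 'cV_n ->
    forall i : 'I_n, (i < n - k)%N -> B *m delta_mx i 0 = delta_mx i 0 :> 'cV_n.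
  move=> Bfix Bj i; rewrite -subSS subSn // ltnS leq_eqVlt.
  by case/orP=> [/eqP ij|]; [have -> : i = j by exact: val_inj|exact: Bfix].
have [Aj|Aj] := eqVneq (A *m delta_mx j 0) (delta_mx j 0 : 'cV_n).
  by apply: IHk => //; [exact: ltnW|exact: fix_step].
have [|u [u1 uj ufix]] := reflection_swap _ Aj; first by rewrite dot_Orthogonal.
have OB : Orthogonal R n (reflection u *m A).
  case: is_mulgroup_Orthogonal => _ OM _; apply: OM => //.
  exact: reflection_Orthogonal.
have [|x [Px xE xa]] := IHk (reflection u *m A) (ltnW kn) OB.
  (* An earlier basis vector stays fixed: [A] fixes it and preserves [dot], so its products with
     [A *m delta_mx j 0] and [delta_mx j 0] agree, which is what [ufix] asks for. *)
  apply: fix_step => [i ij|]; rewrite -mulmxA //.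
  by rewrite Afix // ufix // -{1}(Afix i ij) dot_Orthogonal.
have Pu := pin_unit_vec u1.
exists (vec u * x); split; first exact: pinM.
  rewrite rho_pinM // rho_unit_vec // xE; apply: eq_mulmx_col => v.
  by rewrite -!mulmxA reflectionK.
(* The sign from [alpha (vec u)] cancels the determinant -1 of the reflection. *)
rewrite rmorphM /= alpha_vec xa det_mulmx det_reflection // mulN1r scaleNr.
by rewrite mulrNN scalerAr.
Qed.

Lemma rho_lift A : Orthogonal R n A ->
  exists x, [/\ pin x, rho x = A & alpha x = \det A *: x].
Proof.
move=> OA; apply: (rho_lift_fixing (leqnn n)) => // i.
by rewrite subnn ltn0.
Qed.

(** * Parity and the spinor group *)

(** The lift [y] of [rho x] given by [rho_lift] satisfies the formula, and [x * y^-1] lies in the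
    kernel, so [x] is [y] or [- y]; the formula is linear and passes to [x]. *)
Lemma alpha_pin x : pin x -> alpha x = \det (rho x) *: x.
Proof.
move=> Px; have [y [Py yE ya]] := rho_lift (rho_Orthogonal Px).
have yU := pin_unit Py; have PVy := pinV Py.
have : hom_ker pin rho (x * y^-1).
  split; first exact: pinM.
  rewrite rho_pinM // -yE -rho_pinM //.
  by rewrite mulrV // rho1.
rewrite hom_ker_pin => -[] /(canRL (mulrVK yU)) xE.
  by rewrite {1 3}xE mulN1r raddfN /= ya scalerN.
by rewrite {1 3}xE mul1r.
Qed.

(** By [alpha_pin], evenness of [x] says that [\det (rho x) - 1] annihilates [x], and a unit is
    nonzero. *)
Lemma spinP x : spin x <-> pin x /\ \det (rho x) = 1.
Proof.
split=> [[Px [_ /= ax]]|[Px dx]]; last first.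
  by split=> //; split; [case: Px|rewrite /= alpha_pin // dx scale1r].
split=> //; apply/eqP; rewrite -subr_eq0.
have : (\det (rho x) - 1) *: x = 0.
  by rewrite scalerBl -alpha_pin // ax scale1r subrr.
move/eqP; rewrite scaler_eq0 => /orP[//|/eqP x0].
by have := pin_unit Px; rewrite x0 unitr0.
Qed.

Lemma is_mulgroup_spin : is_mulgroup spin.
Proof.
split=> [|x y /spinP[Px dx] /spinP[Py dy]|x Sx].
- by apply/spinP; split; [exact: pin1|rewrite rho1 det1].
- apply/spinP; split; first exact: pinM.
  by rewrite rho_pinM // det_mulmx dx dy mulr1.
have [Px [_ /= ax]] := Sx; have xU := pin_unit Px; have PV := pinV Px.
exists x^-1; split; [|by rewrite mulrV|by rewrite mulVr].
by split=> //; split; [case: PV|rewrite /= rmorphV //= ax].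
Qed.

Lemma is_mulgroup_SpecialOrthogonal : is_mulgroup (SpecialOrthogonal R n).
Proof.
have [O1 OM OV] := is_mulgroup_Orthogonal.
split=> [|A B [OA dA] [OB dB]|A [OA dA]].
- by split; [exact: O1|exact: det1].
- by split; [exact: OM|rewrite det_mulmx dA dB mulr1].
have [B [OB AB BA]] := OV _ OA; exists B; split=> //; split=> //.
by rewrite -[LHS]mul1r -dA -det_mulmx [A *m B]AB det1.
Qed.

Lemma rho_pin_spin :
  [/\ is_group_hom pin (Orthogonal R n) rho, rho @` pin = Orthogonal R n
    & hom_ker pin rho = [set -1; 1]]
  /\
  [/\ is_group_hom spin (SpecialOrthogonal R n) rho,
      rho @` spin = SpecialOrthogonal R n
    & hom_ker spin rho = [set -1; 1]].
Proof.
split; split.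
- split; [exact: is_mulgroup_pin|exact: is_mulgroup_Orthogonal| |].
    exact: rho_Orthogonal.
  exact: rho_pinM.
- apply/seteqP; split=> [_ [x Px <-]|A OA]; first exact: rho_Orthogonal.
  by have [x [Px xE _]] := rho_lift OA; exists x.
- exact: hom_ker_pin.
- split; [exact: is_mulgroup_spin|exact: is_mulgroup_SpecialOrthogonal| |].
    by move=> x /spinP[Px dx]; split=> //; exact: rho_Orthogonal.
  by move=> x y [Px _] [Py _]; exact: rho_pinM.
- apply/seteqP; split=> [_ [x /spinP[Px dx] <-]|A [OA dA]].
    by split=> //; exact: rho_Orthogonal.
  have [x [Px xE _]] := rho_lift OA; exists x => //.
  by apply/spinP; rewrite xE.
(* Any kernel element in [pin] is already in [spin], since the identity matrix has determinant 1. *)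
rewrite -hom_ker_pin; apply/seteqP; split=> x [Sx rx]; first by case: Sx.
by split=> //; apply/spinP; rewrite rx; split=> //; exact: det1.
Qed.

End AbstractClifford.

(** * Return to the quotient algebra [Cl] *)

(** Every element is the image of a tensor, which is a linear combination of words, and a word is
    built letter by letter from the left. *)
Lemma cl_tail_algebra_all {R : realType} {n} (x : Cl R n) :
  tail_algebra (@cl_vec R n) 0 x.
Proof.
have Sw (w : {fmonom 'I_n}) : tail_algebra (@cl_vec R n) 0 (cl_pi << w >>).
  case: w => w; elim: w => [|i w IHw].
    suff -> : << FMonom [::] >> = 1 :> tensor R n.
      by rewrite rmorph1; exact: tail_algebra1.
    by congr << _ >>; apply/val_inj; rewrite /= fm1.
  suff -> : << FMonom (i :: w) >>
      = tensor_vec (delta_mx i 0) * << FMonom w >> :> tensor R n.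
    rewrite rmorphM.
    exact: (@tail_algebraM _ _ _ (@cl_vec R n) 0 i _ isT IHw).
  have -> : tensor_vec (delta_mx i 0) = << fmu i >> :> tensor R n.
    rewrite /tensor_vec (bigD1 i) //= big1 ?addr0 ?mxE ?eqxx // => j ji.
    by rewrite mxE (negPf ji) monalgU0.
  rewrite malgM_def fgmulUU mulr1; congr << _ >>.
  by apply/val_inj; rewrite /= fmM fmU.
rewrite -[x]cl_repr (monalgE (repr x)) raddf_sum /=.
elim/big_rec: _ => [|w y _ Sy]; first exact: tail_algebra0.
have -> : << (repr x)@_w *g w >> = (repr x)@_w *: (<< w >> : tensor R n).
  by rewrite -malg_scaleU mulr1.
by rewrite linearZ; exact: (tail_algebraP _ (Sw w) Sy).
Qed.

Theorem theorem1p11 (R : realType) (n : nat) (hn : (1 <= n)%N) :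
  [/\ is_group_hom (Pin R n) (Orthogonal R n) (@rho R n),
      @rho R n @` Pin R n = Orthogonal R n
    & hom_ker (Pin R n) (@rho R n) = [set -1; 1]]
  /\
  [/\ is_group_hom (Spin R n) (SpecialOrthogonal R n) (@rho R n),
      @rho R n @` Spin R n = SpecialOrthogonal R n
    & hom_ker (Spin R n) (@rho R n) = [set -1; 1]].
Proof.
(* [Gamma] unfolds to the condition in [GP], whence [iff_refl]; [Pin] and [Spin] are likewise
   convertible to the instances of [pin] and [spin]. *)
exact: (@rho_pin_spin R n (Cl R n) (@cl_vec R n) cl_tail_algebra_all
  (@cl_alpha R n) (@cl_t R n) (@cl_vec_sqr R n) (@cl_alpha_vec R n)
  (@cl_alphaK R n) (@cl_t_vec R n) (@cl_t1 R n) (@cl_tM R n) (@cl_tK R n)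
  (@Gamma R n) (@rho R n) (fun=> iff_refl _) (@cl_vec_inj R n) (@rhoE R n)).
Qed.
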